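(* The protected-sensor placement problem $$\underset{\mathcal{X}_p\subseteq\mathcal{X}}{\text{maximize}}\ G'(\mathcal{X}_p)\qquad\text{subject to}\quad|\mathcal{X}_p|\le k_{\max}$$ is an instance of the submodular problem $$\underset{\mathcal{X}_p}{\text{maximize}}\ F'(\mathcal{X}_p)\qquad\text{subject to}\quad|\mathcal{X}_p|\le k_{\max},$$ where $\mathcal{X}_p$ ranges over subsets of a finite non-empty ground set, $F'$ is a nondecreasing and submodular set function on subsets of the ground set with $F'(\emptyset)=0$, and $k_{\max}\in\mathbb{Z}_{\ge0}$. That is, with ground set $\mathcal{X}$ and $F'=G'$, the function $G'$ is submodular, nondecreasing, and satisfies $G'(\emptyset)=0$.
   Context: Graph. Let $[A]\in\{0,1\}^{n_x\times n_x}$ and $[B]\in\{0,1\}^{n_x\times n_u}$, where the columns of $[B]$ are distinct canonical basis vectors. $\mathcal{X}=\{x_1,\dots,x_{n_x}\}$ (states), $\mathcal{U}=\{u_1,\dots,u_{n_u}\}$ (actuators), with directed edges $(u_j,x_i)$ when $[B](i,j)\neq0$ and $(x_j,x_i)$ when $[A](i,j)\ne0$. Two nodes are adjacent if there is an edge between them. For an actuator $u_i$, $\mathcal{X}_{u_i}\subseteq\mathcal{X}$ is the set of all states $x_k$ for which there exists a directed path $u_i,x_j,\dots,x_k$ in which none of the states is adjacent to an actuator from $\mathcal{U}\setminus\{u_i\}$. Placement problem. $\mathcal{X}_p\subseteq\mathcal{X}$ is the set of states to be measured by new protected sensors, $k_{\max}\in\mathbb{Z}_{\ge0}$ is the available number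 of sensors, and $\mathcal{U}_p\subseteq\mathcal{U}$ is a given subset of actuators. Define $$g'_{u_i}(\mathcal{X}_p)=\min\{|\mathcal{X}_p\cap\mathcal{X}_{u_i}|,1\},\qquad G'(\mathcal{X}_p)=\sum_{u_i\in\mathcal{U}_p}g'_{u_i}(\mathcal{X}_p).$$ Set functions. $F:2^{\mathcal{S}}\to\mathbb{R}$ is submodular if $F(\mathcal{S}_a\cup\{s\})-F(\mathcal{S}_a)\ge F(\mathcal{S}_b\cup\{s\})-F(\mathcal{S}_b)$ for all $\mathcal{S}_a\subseteq\mathcal{S}_b\subseteq\mathcal{S}$ and $s\in\mathcal{S}\setminus\mathcal{S}_b$, and nondecreasing if $F(\mathcal{S}_a)\le F(\mathcal{S}_b)$ for all $\mathcal{S}_a\subseteq\mathcal{S}_b\subseteq\mathcal{S}$. *)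

(* Defs.v *)
From mathcomp Require Import all_boot all_order all_algebra.
From mathcomp Require Import boolp reals.

Set Implicit Arguments.
Unset Strict Implicit.
Unset Printing Implicit Defensive.

Import Order.TTheory GRing.Theory Num.Theory.
Local Open Scope ring_scope.

(* 0/1 matrices are boolean matrices, [true] standing for 1; states are
   indexed by 'I_nx and actuators by 'I_nu. *)

Definition distinct_basis_columns nx nu (B : 'M[bool]_(nx, nu)) : Prop :=
  (forall j : 'I_nu, exists i : 'I_nx, col j B = \col_k (k == i)) /\
  injective (fun j : 'I_nu => col j B).

Definition node nx nu : Type := ('I_nx + 'I_nu)%type.

(* [edge A B v w] is the directed edge from v to w; note the transposition of
   the matrix indices, and that no edge enters an actuator. *)
Definition edge nx nu (A : 'M[bool]_nx) (B : 'M[bool]_(nx, nu))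
    (v w : node nx nu) : bool :=
  match v, w with
  | inr j, inl i => B i j
  | inl j, inl i => A i j
  | _, inr _ => false
  end.

Definition adjacent nx nu (A : 'M[bool]_nx) (B : 'M[bool]_(nx, nu))
    (v w : node nx nu) : bool :=
  edge A B v w || edge A B w v.

(* The path is u, x, s: its states are x :: s (at least one), the last one is
   k.  Repeated states are allowed, which does not affect the existence of a
   path. *)
Definition exclusively_reaches nx nu (A : 'M[bool]_nx)
    (B : 'M[bool]_(nx, nu)) (u : 'I_nu) (k : 'I_nx) : Prop :=
  exists (x : 'I_nx) (s : seq 'I_nx),
    [/\ path (edge A B) (inr u) (map inl (x :: s)),
        last x s = k
      & forall y : 'I_nx, y \in x :: s ->
          forall v : 'I_nu, v != u -> ~~ adjacent A B (inl y) (inr v)].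

Definition exclusive_states nx nu (A : 'M[bool]_nx) (B : 'M[bool]_(nx, nu))
    (u : 'I_nu) : {set 'I_nx} :=
  [set k | `[< exclusively_reaches A B u k >]].

Definition gain_at nx nu (A : 'M[bool]_nx) (B : 'M[bool]_(nx, nu))
    (u : 'I_nu) (Xp : {set 'I_nx}) : nat :=
  minn #|Xp :&: exclusive_states A B u| 1.

Definition gain (R : realType) nx nu (A : 'M[bool]_nx)
    (B : 'M[bool]_(nx, nu)) (Up : {set 'I_nu}) (Xp : {set 'I_nx}) : R :=
  \sum_(u in Up) (gain_at A B u Xp)%:R.

Definition submodular (R : realType) (T : finType) (F : {set T} -> R) : Prop :=
  forall (Sa Sb : {set T}) (s : T), Sa \subset Sb -> s \notin Sb ->
    F (Sa :|: [set s]) - F Sa >= F (Sb :|: [set s]) - F Sb.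

Definition nondecreasing_setfun (R : realType) (T : finType)
    (F : {set T} -> R) : Prop :=
  forall Sa Sb : {set T}, Sa \subset Sb -> F Sa <= F Sb.

(* The data of the problem: maximize [objective S] over the subsets S of
   [ground] subject to #|S| <= [budget]. *)
Record card_max_problem (R : realType) := CardMaxProblem {
  ground : finType;
  objective : {set ground} -> R;
  budget : nat
}.

Definition is_submodular_problem (R : realType) (P : card_max_problem R) :
    Prop :=
  [/\ (0 < #|ground P|)%N,
      submodular (@objective R P),
      nondecreasing_setfun (@objective R P)
    & @objective R P set0 = 0].

Definition placement_problem (R : realType) nx nu (A : 'M[bool]_nx)
    (B : 'M[bool]_(nx, nu)) (Up : {set 'I_nu}) (kmax : nat) :
    card_max_problem R :=
  CardMaxProblem (gain R A B Up) kmax.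

(* Main.v *)
Require Import Defs.
From mathcomp Require Import all_boot all_order all_algebra.
From mathcomp Require Import boolp reals.

(** [gain_at A B u] is the indicator of the sets that meet [exclusive_states A B u].
    Such an indicator is monotone, turns unions into disjunctions, and is
    therefore submodular; all three properties pass to sums over actuators. *)

Import Order.TTheory GRing.Theory Num.Theory.

Section GainAt.
Context {nx nu : nat} (A : 'M[bool]_nx) (B : 'M[bool]_(nx, nu)) (u : 'I_nu).
Implicit Types X Y : {set 'I_nx}.
Local Notation E := (exclusive_states A B u).

Lemma gain_atE X : gain_at A B u X = (X :&: E != set0).
Proof.
rewrite /gain_at -card_gt0.
(* For a positive cardinality, [minn n.+1 1] is [(minn n 0).+1], hence 1. *)
by case: #|_| => [|n]; rewrite ?min0n // minnSS minn0.
Qed.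

Lemma gain_at0 : gain_at A B u set0 = 0.
Proof. by rewrite gain_atE set0I eqxx. Qed.

Lemma gain_at_mono X Y : X \subset Y -> gain_at A B u X <= gain_at A B u Y.
Proof.
move=> sXY; rewrite !gain_atE; case: eqVneq => //= XE0.
suff -> : Y :&: E != set0 by [].
exact: subset_neq0 (setSI _ sXY) XE0.
Qed.

Lemma gain_atU X Y :
  gain_at A B u (X :|: Y) = (0 < gain_at A B u X) || (0 < gain_at A B u Y).
Proof. by rewrite !gain_atE setIUl setU_eq0 negb_and !lt0b. Qed.

(** If [Y] meets [E], adding [Z] to it gains nothing; otherwise [X] misses [E] too and both gains
    agree. The additive form avoids truncated subtraction on [nat]. *)
Lemma gain_at_submodular X Y Z : X \subset Y ->
  gain_at A B u (Y :|: Z) + gain_at A B u X <=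
  gain_at A B u (X :|: Z) + gain_at A B u Y.
Proof.
(* Monotonicity stays as a premise to exclude that [X] meets [E] while [Y] does not; a check on
   three booleans remains. *)
move=> /gain_at_mono; rewrite !gain_atU !gain_atE.
by do 3!case: (_ != set0).
Qed.

End GainAt.

Local Open Scope ring_scope.

Section Gain.
Context (R : realType) {nx nu : nat} (A : 'M[bool]_nx) (B : 'M[bool]_(nx, nu)).
Context (Up : {set 'I_nu}).

Lemma gain0 : gain R A B Up set0 = 0.
Proof. by apply: big1 => u _; rewrite gain_at0. Qed.

Lemma gain_nondecreasing : nondecreasing_setfun (gain R A B Up).
Proof.
by move=> X Y sXY; apply: ler_sum => u _; rewrite ler_nat gain_at_mono.
Qed.

Lemma gain_submodular : submodular (gain R A B Up).
Proof.
move=> X Y s sXY _; rewrite /gain -!sumrB; apply: ler_sum => u _.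
(* Moving the subtracted terms across leaves only sums, so the inequality descends from [R] to
   [nat]. *)
by rewrite lerBlDr addrAC lerBrDr -!natrD ler_nat gain_at_submodular.
Qed.

End Gain.

Local Close Scope ring_scope.

Theorem proposition8 (R : realType) (nx nu : nat) (hnx : (0 < nx)%N)
    (A : 'M[bool]_nx) (B : 'M[bool]_(nx, nu)) (hB : distinct_basis_columns B)
    (Up : {set 'I_nu}) (kmax : nat) :
  is_submodular_problem (placement_problem R A B Up kmax).
Proof.
split; first by rewrite card_ord.
- exact: gain_submodular.
- exact: gain_nondecreasing.
- exact: gain0.
Qed.
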